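(* Let $0<p<1$ and let $f:\{0,1\}^n\to\{0,1\}$. Denote $\mathcal{W}(f)=p(1-p)\sum_{i=1}^nI_i(f)^2$. Then for every $\epsilon\in(0,1]$, \[ \mathcal{S}_\epsilon(f)\le(6e+1)\,\mathcal{W}(f)^{\alpha(\epsilon)\epsilon},\qquad\text{where }\alpha(\epsilon)=\frac{1}{\epsilon+\log(2B(p)e)+3\log\log(2B(p)e)} . \]
   Context: $\{0,1\}^n$ carries the product measure $\mu(x)=\prod_i p^{x_i}(1-p)^{1-x_i}$. For $x\in\{0,1\}^n$, $N_\epsilon(x)$ is the random vector obtained from $x$ by independently keeping each coordinate with probability $1-\epsilon$ and replacing it, with probability $\epsilon$, by a fresh random bit that equals $1$ with probability $p$. The noise stability is $\mathcal{S}_\epsilon(f)=\mathrm{Cov}_{x\sim\mu,\,y\sim N_\epsilon(x)}[f(x),f(y)]$. The influence is $I_i(f)=\Pr_{x\sim\mu}[f(x)\ne f(x\oplus e_i)]$, with $x\oplus e_i$ being $x$ with coordinate $i$ flipped. $B(p)=\frac{(1-p)-p}{2p(1-p)(\ln(1-p)-\ln p)}$ (with $B(1/2)=1$). $\log$ is the natural logarithm. *)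

(* Defs.v *)
From HB Require Import structures.
From mathcomp Require Import all_boot all_order all_algebra.
From mathcomp Require Import reals sequences exp.

Set Implicit Arguments.
Unset Strict Implicit.
Unset Printing Implicit Defensive.

Import Order.TTheory GRing.Theory Num.Theory.
Local Open Scope ring_scope.

Definition cube (n : nat) := {ffun 'I_n -> bool}.

(* A law on a finite type T is given by its mass function w : T -> R. *)
Definition Expect (R : realType) (T : finType) (w : T -> R) (X : T -> R) : R :=
  \sum_(t : T) w t * X t.

Definition Prob (R : realType) (T : finType) (w : T -> R) (A : pred T) : R :=
  \sum_(t : T | A t) w t.

Definition Cov (R : realType) (T : finType) (w : T -> R) (X Y : T -> R) : R :=
  Expect w (fun t => (X t - Expect w X) * (Y t - Expect w Y)).

Definition mu (R : realType) (n : nat) (p : R) (x : cube n) : R :=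
  \prod_(i < n) (p ^+ x i * (1 - p) ^+ (1 - x i)).

(* Coordinate i of x is replaced by the fresh bit z i exactly when r i. *)
Definition resample (n : nat) (x r z : cube n) : cube n :=
  [ffun i => if r i then z i else x i].

(* The law of N_eps(x): the replacement indicators are i.i.d. Bernoulli(eps),
   i.e. r ~ mu eps, and the fresh bits are z ~ mu p, independent of r. *)
Definition noise (R : realType) (n : nat) (p eps : R) (x y : cube n) : R :=
  Prob (fun rz : cube n * cube n => mu eps rz.1 * mu p rz.2)
       (fun rz => resample x rz.1 rz.2 == y).

Definition noise_pair (R : realType) (n : nat) (p eps : R)
    (xy : cube n * cube n) : R :=
  mu p xy.1 * noise p eps xy.1 xy.2.

Definition noise_stability (R : realType) (n : nat) (p eps : R)
    (f : cube n -> bool) : R :=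
  Cov (noise_pair p eps) (fun xy => (f xy.1)%:R) (fun xy => (f xy.2)%:R).

Definition flip (n : nat) (x : cube n) (i : 'I_n) : cube n :=
  [ffun j => x j (+) (j == i)].

Definition influence (R : realType) (n : nat) (p : R) (f : cube n -> bool)
    (i : 'I_n) : R :=
  Prob (@mu R n p) (fun x => f x != f (flip x i)).

Definition W (R : realType) (n : nat) (p : R) (f : cube n -> bool) : R :=
  p * (1 - p) * \sum_(i < n) influence p f i ^+ 2.

Definition B (R : realType) (p : R) : R :=
  if p == 1 / 2 then 1
  else ((1 - p) - p) / (2 * p * (1 - p) * (ln (1 - p) - ln p)).

Definition alpha (R : realType) (p eps : R) : R :=
  1 / (eps + ln (2 * B p * expR 1) + 3 * ln (ln (2 * B p * expR 1))).

(* Main.v *)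
(** Let [c S] be the [p]-biased Fourier coefficients of [f] and [g_i] the function
    [f] minus its average over coordinate [i]. The noise stability is the sum of
    [(1 - eps) ^+ #|S| * c S ^+ 2] over nonempty [S], and [g_i] has [L^1]-norm
    [2 p (1 - p) I_i].

    If [6 u ^+ 2 (p / (1 - p) + (1 - p) / p) <= 1], a two-point inequality, tensorized
    over the coordinates, shows that the noise operator [T_u] satisfies
    [E (T_u h) ^+ 4 <= <h, T_u h> ^+ 2], and two uses of Cauchy-Schwarz turn this into
    [<h, T_u h> <= |h|_1 |h|_2]. Apply it to [h_i = T_w g_i] with [w = expR (- delta)]
    and sum over [i]: since [|h_i|_2 ^+ 2] sums to
    [\sum_S #|S| w ^+ (2 #|S|) c S ^+ 2 <= 1 / (2 delta)], the stability at rate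
    [r = u w ^+ 2] is at most [sqrt (W / (2 delta))]. Jensen's inequality for
    [t |-> t `^ (2 eps / (eps + M))] carries the bound from [r = expR (- M / 2)] to the
    rate [1 - eps].

    With [z = ln ((1 - p) / p)] one has [p / (1 - p) + (1 - p) / p = 2 cosh z] and
    [B p = sinh z / z], so that for [M = ln (2 B e) + 3 ln (ln (2 B e))] and
    [delta = 1 / 72] the condition on [u] becomes an inequality between hyperbolic
    functions of [z]. *)

Require Import Defs.
From mathcomp Require Import all_boot all_order all_algebra.
From mathcomp Require Import reals sequences exp bernoulli_distribution.
From mathcomp Require Import ring lra.

Set Implicit Arguments.
Unset Strict Implicit.
Unset Printing Implicit Defensive.

Import Order.TTheory GRing.Theory Num.Theory.
Local Open Scope ring_scope.

Lemma Cauchy_Schwarz_sum (R : rcfType) (I : finType) (x a b : I -> R) :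
  (forall i, 0 <= a i) -> (forall i, 0 <= b i) ->
  (forall i, x i ^+ 2 <= a i * b i) ->
  (\sum_i x i) ^+ 2 <= (\sum_i a i) * \sum_i b i.
Proof.
move=> a_ge0 b_ge0 x2_le.
pose P := Poly [:: \sum_i b i; 2 * \sum_i x i; \sum_i a i].
suff P_ge0 s : 0 <= P.[s].
  have := deg_le2_poly_ge0 (size_Poly _ : (size P <= 3)%N) P_ge0.
  by rewrite !coef_Poly/=; lra.
rewrite horner_Poly/= mul0r add0r.
have -> : ((\sum_i a i) * s + 2 * \sum_i x i) * s + \sum_i b i =
    \sum_i (a i * s ^+ 2 + 2 * x i * s + b i).
  by rewrite !big_split/= -!mulr_suml -mulr_sumr; ring.
apply: sumr_ge0 => i _; have [ai0|ai_neq0] := eqVneq (a i) 0.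
  have /eqP -> : x i == 0.
    by rewrite -sqrf_eq0 eq_le sqr_ge0 andbT -[leRHS](mul0r (b i)) -ai0.
  by rewrite ai0 mul0r mulr0 mul0r !add0r.
have ai_gt0 : 0 < a i by rewrite lt_def ai_neq0 a_ge0.
rewrite -(pmulr_rge0 _ ai_gt0).
by have := sqr_ge0 (a i * s + x i); have := x2_le i; lra.
Qed.

Lemma indicator_eq_ffun (R : comPzSemiRingType) (I : finType) (T : eqType)
    (f g : {ffun I -> T}) :
  (f == g)%:R = \prod_i (f i == g i)%:R :> R.
Proof.
have [->|neq_fg] := eqVneq f g; first by rewrite big1// => i _; rewrite eqxx.
have [i fi_neq] : exists i, f i != g i.
  apply/existsP; apply: contraR neq_fg; rewrite negb_exists => /forallP eq_fg.
  by apply/eqP/ffunP => i; apply/eqP/negPn.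
by rewrite (bigD1 i)//= (negbTE fi_neq) mul0r.
Qed.

Lemma set_ind (T : finType) (P : {set T} -> Prop) :
  P set0 -> (forall i (A : {set T}), i \notin A -> P A -> P (i |: A)) ->
  forall A, P A.
Proof.
move=> P0 PU A; have [k] := ubnP #|A|; elim: k A => // k IHk A.
have [->//|[i iA]] := set_0Vmem A; rewrite (cardsD1 i) iA ltnS => Ak.
by rewrite -(setD1K iA); apply: PU; [rewrite setD11 | exact: IHk].
Qed.

Lemma sum_subset_setU1 (V : nmodType) (I : finType) (F : {set I} -> V) i
    (A : {set I}) : i \notin A ->
  \sum_(S : {set I} | S \subset i |: A) F S =
  \sum_(S : {set I} | S \subset A) F S +
  \sum_(S : {set I} | S \subset A) F (i |: S).
Proof.
move=> iA; rewrite (bigID (fun S : {set I} => i \in S))/= addrC; congr (_ + _).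
  by apply: eq_bigl => S; rewrite -subsetD1 setU1K.
rewrite (reindex_onto (fun S => i |: S) (fun S => S :\ i))/=; last first.
  by move=> S /andP[_ iS]; rewrite setD1K.
apply: eq_bigl => S; rewrite setU11 andbT subUset sub1set setU11/=.
have -> : ((i |: S) :\ i == S) = (i \notin S).
  by apply/eqP/idP => [<-|iS]; rewrite ?setD11 ?setU1K.
by rewrite -subsetD1 setU1K.
Qed.

Lemma sum_mem_card (R : pzSemiRingType) (I : finType) (F : {set I} -> R) :
  \sum_i \sum_(S : {set I}) (i \in S)%:R * F S =
  \sum_(S : {set I}) #|S|%:R * F S.
Proof.
rewrite exchange_big; apply: eq_bigr => S _ /=; rewrite -mulr_suml; congr (_ * _).
by rewrite -natr_sum -sum1_card [X in _ = X%:R]big_mkcond.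
Qed.

(* [k3] and [k4] stand for the third and fourth moments of a centred variable of
   variance 1. *)
Lemma quartic_form_le (R : realFieldType) (u k3 k4 a b : R) :
  0 <= u -> k3 ^+ 2 <= k4 -> 1 <= k4 -> 6 * u ^+ 2 * (1 + k4) <= 1 ->
  a ^+ 4 + 6 * u ^+ 2 * a ^+ 2 * b ^+ 2 + 4 * u ^+ 3 * k3 * a * b ^+ 3 +
    u ^+ 4 * k4 * b ^+ 4 <= (a ^+ 2 + u * b ^+ 2) ^+ 2.
Proof.
move=> u_ge0 k3_le k4_ge1 u_le; have u2_ge0 := sqr_ge0 u.
have u2_le : u ^+ 2 <= 1 / 12.
  by have := ler_wpM2l u2_ge0 k4_ge1; lra.
have u2k4_le : u ^+ 2 * k4 <= 1 / 6 by lra.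
have uk3_le : (u * k3) ^+ 2 <= 1 / 6.
  by apply: le_trans u2k4_le; rewrite exprMn ler_wpM2l.
have u_small : u <= 5 / 17 by rewrite -ler_sqr ?nnegrE//; lra.
(* AM-GM: [4 (u k3) a b <= 24/5 (u k3)^2 a^2 + 5/6 b^2] *)
have cross_le : 4 * (u * k3) * a * b <= 4 / 5 * a ^+ 2 + 5 / 6 * b ^+ 2.
  have := ler_wpM2r (sqr_ge0 a) uk3_le.
  by have := sqr_ge0 (12 * (u * k3) * a - 5 * b); lra.
have cubic_le := ler_wpM2l (sqr_ge0 (u * b)) cross_le.
have quartic_le := ler_wpM2l (sqr_ge0 (u * b ^+ 2)) u2k4_le.
have mixed_le := ler_wpM2l (mulr_ge0 u_ge0 (sqr_ge0 (a * b))) u_small.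
lra.
Qed.

Section Expectation.
Variables (R : realType) (T : finType) (w : T -> R).
Implicit Types X Y : T -> R.

Lemma eq_Expect X Y : X =1 Y -> Expect w X = Expect w Y.
Proof. by move=> XY; apply: eq_bigr => t _; rewrite XY. Qed.

Lemma ExpectD X Y : Expect w (fun t => X t + Y t) = Expect w X + Expect w Y.
Proof. by rewrite /Expect -big_split; apply: eq_bigr => t _; rewrite mulrDr. Qed.

Lemma ExpectZ a X : Expect w (fun t => a * X t) = a * Expect w X.
Proof. by rewrite /Expect mulr_sumr; apply: eq_bigr => t _; rewrite mulrCA. Qed.

Hypothesis w_ge0 : forall t, 0 <= w t.

Lemma Expect_ge0 X : (forall t, 0 <= X t) -> 0 <= Expect w X.
Proof. by move=> X_ge0; apply: sumr_ge0 => t _; rewrite mulr_ge0. Qed.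

Lemma Expect_sqr_ge0 X : 0 <= Expect w (fun t => X t ^+ 2).
Proof. by apply: Expect_ge0 => t; exact: sqr_ge0. Qed.

Lemma ler_Expect X Y : (forall t, X t <= Y t) -> Expect w X <= Expect w Y.
Proof. by move=> XY; apply: ler_sum => t _; rewrite ler_wpM2l. Qed.

Lemma Cauchy_Schwarz_Expect X Y Z :
  (forall t, 0 <= Y t) -> (forall t, 0 <= Z t) ->
  (forall t, X t ^+ 2 <= Y t * Z t) ->
  Expect w X ^+ 2 <= Expect w Y * Expect w Z.
Proof.
move=> Y_ge0 Z_ge0 X2_le; apply: Cauchy_Schwarz_sum => t; rewrite ?mulr_ge0//.
by rewrite exprMn [leRHS]mulrACA -expr2 ler_wpM2l// sqr_ge0.
Qed.

Hypothesis w_sum1 : Expect w (fun=> 1) = 1.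

Lemma Expect_cst a : Expect w (fun=> a) = a.
Proof.
by rewrite -[RHS]mulr1 -w_sum1 -ExpectZ; apply: eq_Expect => t; rewrite mulr1.
Qed.

Lemma CovE X Y :
  Cov w X Y = Expect w (fun t => X t * Y t) - Expect w X * Expect w Y.
Proof.
rewrite /Cov; set x := Expect w X; set y := Expect w Y.
under eq_Expect => t.
  rewrite (_ : _ * _ = X t * Y t + (- y * X t + (- x * Y t + x * y))); last by ring.
  over.
rewrite !ExpectD !ExpectZ Expect_cst -/x -/y; ring.
Qed.

Lemma Expect_affine_pow4 X u a b :
  Expect w X = 0 -> Expect w (fun t => X t ^+ 2) = 1 ->
  Expect w (fun t => (a + u * X t * b) ^+ 4) =
  a ^+ 4 + 6 * u ^+ 2 * a ^+ 2 * b ^+ 2 +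
  4 * u ^+ 3 * Expect w (fun t => X t ^+ 3) * a * b ^+ 3 +
  u ^+ 4 * Expect w (fun t => X t ^+ 4) * b ^+ 4.
Proof.
move=> EX EX2; under eq_Expect => t.
  rewrite (_ : _ ^+ 4 = a ^+ 4 + (4 * a ^+ 3 * u * b * X t +
    (6 * u ^+ 2 * a ^+ 2 * b ^+ 2 * X t ^+ 2 +
    (4 * u ^+ 3 * a * b ^+ 3 * X t ^+ 3 + u ^+ 4 * b ^+ 4 * X t ^+ 4)))); last by ring.
  over.
by rewrite !ExpectD !ExpectZ Expect_cst EX EX2; ring.
Qed.

Lemma fourth_moment_le X u a b :
  Expect w X = 0 -> Expect w (fun t => X t ^+ 2) = 1 -> 0 <= u ->
  6 * u ^+ 2 * (1 + Expect w (fun t => X t ^+ 4)) <= 1 ->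
  Expect w (fun t => (a + u * X t * b) ^+ 4) <= (a ^+ 2 + u * b ^+ 2) ^+ 2.
Proof.
move=> EX EX2 u_ge0 u_le; rewrite Expect_affine_pow4//; apply: quartic_form_le => //.
- rewrite -[leRHS]mul1r -EX2; apply: Cauchy_Schwarz_Expect => t.
  + exact: sqr_ge0.
  + by rewrite exprn_even_ge0.
  + by rewrite -exprM -exprD.
- rewrite -(expr1n _ 2) -EX2 -[leRHS]mul1r -[X in _ <= X * _]w_sum1.
  apply: Cauchy_Schwarz_Expect => t //; first by rewrite exprn_even_ge0.
  by rewrite -exprM mul1r.
Qed.

End Expectation.

Section BiasedBit.
Variables (R : realType) (p : R).
Hypotheses (p_gt0 : 0 < p) (p_lt1 : p < 1).
Local Notation q := (1 - p).

Definition phi (b : bool) : R :=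
  if b then Num.sqrt (p * q) / p else - (Num.sqrt (p * q) / q).

Let q_gt0 : 0 < q. Proof. by rewrite subr_gt0. Qed.
Let p_neq0 : p != 0. Proof. by rewrite gt_eqF. Qed.
Let q_neq0 : q != 0. Proof. by rewrite gt_eqF. Qed.

Lemma bernoulli_pmf_gt0 b : 0 < bernoulli_pmf p b. Proof. by case: b. Qed.

Lemma Expect_bernoulli c (F : bool -> R) :
  Expect (bernoulli_pmf p) F =
  bernoulli_pmf p c * F c + bernoulli_pmf p (~~ c) * F (~~ c).
Proof. by rewrite /Expect big_bool; case: c => //=; rewrite addrC. Qed.

Lemma phi_mul b c :
  phi b * phi c = (b == c)%:R / bernoulli_pmf p c - 1.
Proof.
have sqrt_pq_sqr : Num.sqrt (p * q) ^+ 2 = p * q.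
  by rewrite sqr_sqrtr// ltW// mulr_gt0.
rewrite /phi /bernoulli_pmf; case: b; case: c => /=; rewrite ?mulrNN ?mulrN ?mulNr;
  by rewrite mulrACA -expr2 sqrt_pq_sqr; field; rewrite ?p_neq0 ?q_neq0.
Qed.

Lemma Expect_phi : Expect (bernoulli_pmf p) phi = 0.
Proof. by rewrite (Expect_bernoulli true) /= /phi; field; rewrite p_neq0 q_neq0. Qed.

Lemma Expect_phi_sqr : Expect (bernoulli_pmf p) (fun b => phi b ^+ 2) = 1.
Proof.
rewrite (Expect_bernoulli true) !expr2 !phi_mul /bernoulli_pmf/=.
by field; rewrite p_neq0 q_neq0.
Qed.

Lemma Expect_phi_quartic :
  1 + Expect (bernoulli_pmf p) (fun b => phi b ^+ 4) = p / q + q / p.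
Proof.
rewrite (Expect_bernoulli true) -[4%N]/(2 * 2)%N !exprM !expr2 !phi_mul.
by rewrite /bernoulli_pmf/=; field; rewrite p_neq0 q_neq0.
Qed.

Definition hypercontractive_rate (u : R) : bool :=
  (0 <= u) && (6 * u ^+ 2 * (p / q + q / p) <= 1).

Lemma two_point_inequality u a b : hypercontractive_rate u ->
  Expect (bernoulli_pmf p) (fun t => (a + u * phi t * b) ^+ 4) <=
  (a ^+ 2 + u * b ^+ 2) ^+ 2.
Proof.
case/andP=> u_ge0 u_le; apply: fourth_moment_le => //.
- by move=> t; rewrite ltW// bernoulli_pmf_gt0.
- by rewrite (Expect_bernoulli true)/= !mulr1 subrKC.
- exact: Expect_phi.
- exact: Expect_phi_sqr.
- by rewrite Expect_phi_quartic.
Qed.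

End BiasedBit.

Lemma muE (R : realType) (n : nat) (p : R) (x : cube n) :
  mu p x = \prod_i bernoulli_pmf p (x i).
Proof.
by apply: eq_bigr => i _; case: (x i); rewrite ?expr1 ?expr0 ?mulr1 ?mul1r.
Qed.

Section BiasedFourier.
Variables (R : realType) (n : nat) (p : R).
Hypotheses (p_gt0 : 0 < p) (p_lt1 : p < 1).
Implicit Types (x y : cube n) (f g : cube n -> R) (S : {set 'I_n}).
Local Notation E := (Expect (@mu R n p)).

Definition chi S x : R := \prod_(i in S) phi p (x i).

Definition coef f S : R := E (fun x => f x * chi S x).

Definition noise_kernel rho x y : R :=
  \prod_i (rho * (x i == y i)%:R + (1 - rho) * bernoulli_pmf p (y i)).

Definition noise_op rho f x : R := \sum_y noise_kernel rho x y * f y.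

Lemma chi0 x : chi set0 x = 1. Proof. by rewrite /chi big_set0. Qed.

Lemma mu_ge0 x : 0 <= mu p x.
Proof. by rewrite muE prodr_ge0// => i _; rewrite ltW// bernoulli_pmf_gt0. Qed.

Lemma mu_sum1 : E (fun=> 1) = 1.
Proof.
rewrite /Expect; under eq_bigr do rewrite mulr1 muE.
rewrite -(bigA_distr_bigA (fun _ b => bernoulli_pmf p b)).
by apply: big1 => i _; rewrite big_bool/= subrKC.
Qed.

Lemma coef_set0 f : coef f set0 = E f.
Proof. by apply: eq_Expect => x; rewrite chi0 mulr1. Qed.

Lemma fourier_inversion f x : f x = \sum_(S : {set 'I_n}) coef f S * chi S x.
Proof.
have chi_complete y : mu p y * \sum_(S : {set 'I_n}) chi S y * chi S x = (y == x)%:R.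
  transitivity (mu p y * \prod_i (phi p (y i) * phi p (x i) + 1)).
    congr (_ * _); rewrite bigA_distr; apply: eq_bigr => S _.
    by rewrite -big_mkcond big_split.
  rewrite muE -big_split indicator_eq_ffun; apply: eq_bigr => i _ /=.
  rewrite phi_mul// subrK mulrC.
  have [->|] := eqVneq (y i) (x i); last by rewrite !mul0r.
  by rewrite mulfVK// gt_eqF// bernoulli_pmf_gt0.
rewrite [LHS](_ : _ = \sum_y (y == x)%:R * f y); last first.
  rewrite (bigD1 x)//= eqxx mul1r big1 ?addr0// => y yx.
  by rewrite (negbTE yx) mul0r.
under eq_bigr do rewrite -chi_complete mulr_sumr mulr_suml.
rewrite exchange_big; apply: eq_bigr => S _; rewrite /coef /Expect mulr_suml.
by apply: eq_bigr => y _; ring.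
Qed.

Lemma parseval f g :
  E (fun x => f x * g x) = \sum_(S : {set 'I_n}) coef f S * coef g S.
Proof.
rewrite /Expect; under eq_bigr do rewrite [g _]fourier_inversion !mulr_sumr.
rewrite exchange_big; apply: eq_bigr => S _; rewrite /coef /Expect mulr_suml.
by apply: eq_bigr => x _; ring.
Qed.

Lemma noise_kernel_ge0 rho x y : 0 <= rho <= 1 -> 0 <= noise_kernel rho x y.
Proof.
case/andP=> rho_ge0 rho_le1; apply: prodr_ge0 => i _.
by rewrite addr_ge0// mulr_ge0 ?ler0n ?subr_ge0// ltW ?bernoulli_pmf_gt0.
Qed.

Lemma noise_kernel_reversible rho x y :
  mu p x * noise_kernel rho x y = mu p y * noise_kernel rho y x.
Proof.
rewrite !muE -!big_split; apply: eq_bigr => i _ /=; rewrite [y i == x i]eq_sym.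
by have [->|_] := eqVneq (x i) (y i) => //=; ring.
Qed.

Lemma noise_op_selfadjoint rho f g :
  E (fun x => noise_op rho f x * g x) = E (fun x => f x * noise_op rho g x).
Proof.
rewrite /Expect /noise_op.
under eq_bigr do rewrite mulr_suml mulr_sumr.
under [RHS]eq_bigr do rewrite !mulr_sumr.
rewrite exchange_big; apply: eq_bigr => x _; apply: eq_bigr => y _ /=.
by rewrite !mulrA noise_kernel_reversible; ring.
Qed.

Lemma noise_op_chi rho S x : noise_op rho (chi S) x = rho ^+ #|S| * chi S x.
Proof.
pose F i b : R := (rho * (x i == b)%:R + (1 - rho) * bernoulli_pmf p b) *
  (if i \in S then phi p b else 1).
have -> : noise_op rho (chi S) x = \prod_i \sum_b F i b.
  rewrite bigA_distr_bigA; apply: eq_bigr => y _.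
  by rewrite /chi (big_mkcond (fun i => i \in S)) -big_split.
rewrite -prodr_const -big_split [RHS]big_mkcond; apply: eq_bigr => i _ /=.
rewrite /F big_bool; case: ifP => iS.
  have := Expect_phi p_gt0 p_lt1; rewrite (Expect_bernoulli p true)/= => Ephi.
  transitivity (rho * phi p (x i) +
      (1 - rho) * (p * phi p true + (1 - p) * phi p false)).
    by case: (x i) => /=; ring.
  by rewrite Ephi mulr0 addr0.
by rewrite /bernoulli_pmf/=; case: (x i) => /=; ring.
Qed.

Lemma noise_op1 rho x : noise_op rho (fun=> 1) x = 1.
Proof.
transitivity (noise_op rho (chi set0) x).
  by apply: eq_bigr => y _; rewrite chi0.
by rewrite noise_op_chi cards0 chi0 mulr1.
Qed.

Lemma coef_noise_op rho f S : coef (noise_op rho f) S = rho ^+ #|S| * coef f S.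
Proof.
rewrite /coef noise_op_selfadjoint -ExpectZ; apply: eq_Expect => x.
by rewrite noise_op_chi mulrCA.
Qed.

Definition noise_form rho f : R := E (fun x => f x * noise_op rho f x).

Lemma noise_formE rho f :
  noise_form rho f = \sum_(S : {set 'I_n}) rho ^+ #|S| * coef f S ^+ 2.
Proof.
by rewrite /noise_form parseval; apply: eq_bigr => S _; rewrite coef_noise_op; ring.
Qed.

Lemma Expect_noise_op rho f : E (noise_op rho f) = E f.
Proof.
transitivity (E (fun x => noise_op rho f x * 1)).
  by apply: eq_Expect => x; rewrite mulr1.
by rewrite noise_op_selfadjoint; apply: eq_Expect => x; rewrite noise_op1 mulr1.
Qed.

Lemma noise_op_L1_contraction rho f : 0 <= rho <= 1 ->
  E (fun x => `|noise_op rho f x|) <= E (fun x => `|f x|).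
Proof.
move=> rho01; rewrite -[leRHS](Expect_noise_op rho); apply: ler_Expect => x.
  exact: mu_ge0.
apply: le_trans (ler_norm_sum _ _ _) _; apply: ler_sum => y _.
by rewrite normrM ger0_norm// noise_kernel_ge0.
Qed.

Lemma noiseE eps x y : noise p eps x y = noise_kernel (1 - eps) x y.
Proof.
pose G i (r z : bool) : R := bernoulli_pmf eps r * bernoulli_pmf p z *
  ((if r then z else x i) == y i)%:R.
have -> : noise p eps x y =
    \sum_(r : cube n) \sum_(z : cube n) \prod_i G i (r i) (z i).
  rewrite /noise /Prob pair_big/= big_mkcond; apply: eq_bigr => -[r z] _ /=.
  rewrite !big_split/= -!muE.
  have -> : \prod_i ((if r i then z i else x i) == y i)%:R =
      (resample x r z == y)%:R :> R.
    by rewrite indicator_eq_ffun; apply: eq_bigr => i _; rewrite ffunE.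
  by case: ifP; rewrite ?mulr1 ?mulr0.
under eq_bigr do rewrite -(bigA_distr_bigA (fun i b => G i (_ i) b)).
rewrite -(bigA_distr_bigA (fun i a => \sum_b G i a b)).
apply: eq_bigr => i _; rewrite !big_bool /G /bernoulli_pmf /=.
by case: (x i); case: (y i) => /=; ring.
Qed.

Lemma Expect_noise_pair eps f g :
  Expect (noise_pair p eps) (fun xy => f xy.1 * g xy.2) =
  E (fun x => f x * noise_op (1 - eps) g x).
Proof.
rewrite /Expect -(pair_big xpredT xpredT
  (fun x y => noise_pair p eps (x, y) * (f x * g y)))/=.
apply: eq_bigr => x _; rewrite /noise_op !mulr_sumr; apply: eq_bigr => y _.
by rewrite /noise_pair/= noiseE; ring.
Qed.

Lemma Expect_noise_pair_fst eps f :
  Expect (noise_pair p eps) (fun xy => f xy.1) = E f.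
Proof.
transitivity (Expect (noise_pair p eps) (fun xy => f xy.1 * 1)).
  by apply: eq_Expect => xy; rewrite mulr1.
rewrite (Expect_noise_pair _ f (fun=> 1)).
by apply: eq_Expect => x; rewrite noise_op1 mulr1.
Qed.

Lemma Expect_noise_pair_snd eps f :
  Expect (noise_pair p eps) (fun xy => f xy.2) = E f.
Proof.
transitivity (Expect (noise_pair p eps) (fun xy => 1 * f xy.2)).
  by apply: eq_Expect => xy; rewrite mul1r.
rewrite (Expect_noise_pair _ (fun=> 1)) -[RHS](Expect_noise_op (1 - eps)).
by apply: eq_Expect => x; rewrite mul1r.
Qed.

Definition spectral_stability rho f : R :=
  \sum_(S : {set 'I_n} | S != set0) rho ^+ #|S| * coef f S ^+ 2.

Lemma spectral_stability_ge0 rho f : 0 <= rho -> 0 <= spectral_stability rho f.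
Proof.
by move=> rho_ge0; apply: sumr_ge0 => S _; rewrite mulr_ge0 ?sqr_ge0 ?exprn_ge0.
Qed.

Lemma noise_stabilityE eps (f : cube n -> bool) :
  noise_stability p eps f = spectral_stability (1 - eps) (fun x => (f x)%:R).
Proof.
pose F x : R := (f x)%:R.
have noise_pair_sum1 := etrans (Expect_noise_pair_fst eps (fun=> 1)) mu_sum1.
rewrite /noise_stability CovE// (Expect_noise_pair_fst _ F).
rewrite (Expect_noise_pair_snd _ F) (Expect_noise_pair _ F F).
rewrite -/(noise_form (1 - eps) F) noise_formE (bigD1 set0)//= cards0 mul1r coef_set0.
by rewrite addrAC -expr2 subrr add0r.
Qed.

End BiasedFourier.

Section Coordinates.
Variables (R : realType) (n : nat) (p : R).
Hypotheses (p_gt0 : 0 < p) (p_lt1 : p < 1).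
Implicit Types (x : cube n) (i : 'I_n) (S : {set 'I_n}) (f : cube n -> R).
Local Notation E := (Expect (@mu R n p)).

Lemma flipK i : involutive (fun x => flip x i).
Proof. by move=> x; apply/ffunP => j; rewrite !ffunE addbK. Qed.

Lemma flip_same x i : flip x i i = ~~ x i.
Proof. by rewrite ffunE eqxx addbT. Qed.

Lemma flip_other x i j : j != i -> flip x i j = x j.
Proof. by move=> ji; rewrite ffunE (negbTE ji) addbF. Qed.

Lemma mu_flip x i :
  mu p (flip x i) * bernoulli_pmf p (x i) = mu p x * bernoulli_pmf p (~~ x i).
Proof.
rewrite !muE (bigD1 i)//= [in RHS](bigD1 i)//= flip_same.
rewrite (eq_bigr (fun j => bernoulli_pmf p (x j))); first by ring.
by move=> j ji; rewrite flip_other.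
Qed.

Lemma Expect_resample i f :
  E f = E (fun x => bernoulli_pmf p (x i) * f x +
                    bernoulli_pmf p (~~ x i) * f (flip x i)).
Proof.
rewrite ExpectD [X in _ = _ + X]/Expect (reindex_inj (inv_inj (flipK i)))/=.
rewrite -big_split/=; apply: eq_bigr => x _.
rewrite flipK flip_same negbK [X in _ = _ + X]mulrA mu_flip.
by rewrite /bernoulli_pmf; case: (x i) => /=; ring.
Qed.

Lemma chi_flip_notin S i x : i \notin S -> chi p S (flip x i) = chi p S x.
Proof.
move=> iS; apply: eq_bigr => j jS; rewrite flip_other//.
by apply: contraNneq iS => <-.
Qed.

Lemma chi_setU1 S i x : i \notin S -> chi p (i |: S) x = phi p (x i) * chi p S x.
Proof. by move=> iS; rewrite /chi big_setU1. Qed.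

(* This is [f] minus its average over coordinate [i]. *)
Definition coord_part i f x : R := bernoulli_pmf p (~~ x i) * (f x - f (flip x i)).

Lemma coef_coord_part i f S : coef p (coord_part i f) S = (i \in S)%:R * coef p f S.
Proof.
rewrite /coef (Expect_resample i) [in RHS](Expect_resample i) -ExpectZ.
apply: eq_Expect => x; rewrite /coord_part flipK flip_same negbK.
have [iS|iS] := boolP (i \in S); last by rewrite chi_flip_notin//= mul0r; ring.
rewrite mul1r -(setD1K iS) !chi_setU1 ?setD11// chi_flip_notin ?setD11// flip_same.
have := Expect_phi p_gt0 p_lt1; rewrite (Expect_bernoulli p (x i)) => Ephi.
set b := bernoulli_pmf p (x i) in Ephi *.
set b' := bernoulli_pmf p (~~ x i) in Ephi *.
have bb' : b' = 1 - b by rewrite /b /b' /bernoulli_pmf; case: (x i) => /=; ring.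
apply/eqP; rewrite -subr_eq0; apply/eqP.
set s := phi p (x i) in Ephi *; set s' := phi p (~~ x i) in Ephi *.
transitivity
  (- (b * s + b' * s') * (b * f x + b' * f (flip x i)) * chi p (S :\ i) x).
  by rewrite bb'; ring.
by rewrite Ephi oppr0 !mul0r.
Qed.

Lemma Expect_norm_coord_part (f : cube n -> bool) i :
  E (fun x => `|coord_part i (fun y => (f y)%:R) x|) =
  2 * p * (1 - p) * influence p f i.
Proof.
transitivity (E (fun x => bernoulli_pmf p (~~ x i) * (f x != f (flip x i))%:R)).
  apply: eq_Expect => x; rewrite normrM ger0_norm; last first.
    by rewrite ltW// bernoulli_pmf_gt0.
  congr (_ * _); case: (f x); case: (f _);
    by rewrite ?subrr ?normr0 ?subr0 ?normr1 ?sub0r ?normrN ?normr1.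
have -> : influence p f i = E (fun x => (f x != f (flip x i))%:R).
  rewrite /influence /Prob big_mkcond; apply: eq_bigr => x _.
  by case: ifP; rewrite ?mulr1 ?mulr0.
rewrite (Expect_resample i) -ExpectZ; apply: eq_Expect => x.
rewrite flipK flip_same negbK (eq_sym (f (flip x i))) /bernoulli_pmf.
by case: (x i) => /=; ring.
Qed.

End Coordinates.

Section Hypercontractivity.
Variables (R : realType) (n : nat) (p u : R).
Hypotheses (p_gt0 : 0 < p) (p_lt1 : p < 1) (u_rate : hypercontractive_rate p u).
Implicit Types (i : 'I_n) (S A : {set 'I_n}) (f : cube n -> R).
Local Notation E := (Expect (@mu R n p)).

Let u_ge0 : 0 <= u. Proof. by case/andP: u_rate. Qed.
Let mu_nneg (x : cube n) : 0 <= mu p x. Proof. exact: mu_ge0. Qed.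

Lemma fourth_moment_tensor i (a b : cube n -> R) (alpha beta : R) :
  (forall x, a (flip x i) = a x) -> (forall x, b (flip x i) = b x) ->
  0 <= alpha -> 0 <= beta ->
  E (fun x => a x ^+ 4) <= alpha ^+ 2 -> E (fun x => b x ^+ 4) <= beta ^+ 2 ->
  E (fun x => (a x + u * phi p (x i) * b x) ^+ 4) <= (alpha + u * beta) ^+ 2.
Proof.
move=> a_flip b_flip alpha_ge0 beta_ge0 Ea4 Eb4.
have Ea2b2 : E (fun x => a x ^+ 2 * b x ^+ 2) <= alpha * beta.
  rewrite -ler_sqr ?nnegrE ?mulr_ge0//; last first.
    by apply: Expect_ge0 => // x; rewrite mulr_ge0 ?sqr_ge0.
  rewrite [leRHS]exprMn; apply: le_trans (ler_pM _ _ Ea4 Eb4).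
  - by apply: Cauchy_Schwarz_Expect => // x;
      rewrite ?exprn_even_ge0// exprMn -!exprM.
  - by apply: Expect_ge0 => // x; rewrite exprn_even_ge0.
  - by apply: Expect_ge0 => // x; rewrite exprn_even_ge0.
apply: (@le_trans _ _ (E (fun x => (a x ^+ 2 + u * b x ^+ 2) ^+ 2))).
  rewrite (Expect_resample p i); apply: ler_Expect => // x.
  rewrite a_flip b_flip flip_same.
  apply: le_trans (two_point_inequality p_gt0 p_lt1 _ _ u_rate).
  by rewrite (Expect_bernoulli p (x i)).
under eq_Expect => x.
  rewrite (_ : _ ^+ 2 = a x ^+ 4 +
    (2 * u * (a x ^+ 2 * b x ^+ 2) + u ^+ 2 * b x ^+ 4)); last by ring.
  over.
rewrite !ExpectD !ExpectZ.
rewrite (_ : (alpha + _) ^+ 2 =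
  alpha ^+ 2 + (2 * u * (alpha * beta) + u ^+ 2 * beta ^+ 2)); last by ring.
by rewrite !lerD// ler_wpM2l// ?mulr_ge0 ?sqr_ge0.
Qed.

Lemma hypercontractivity_subset A (c : {set 'I_n} -> R) :
  E (fun x =>
       (\sum_(S : {set 'I_n} | S \subset A) u ^+ #|S| * c S * chi p S x) ^+ 4) <=
  (\sum_(S : {set 'I_n} | S \subset A) u ^+ #|S| * c S ^+ 2) ^+ 2.
Proof.
elim/set_ind: A c => [|i A iA IH] c.
  have subset0E (S : {set 'I_n}) : (S \subset set0) = (S == set0) by rewrite subset0.
  under [X in _ <= X ^+ 2]eq_bigl do rewrite subset0E.
  rewrite big_pred1_eq cards0 mul1r -exprM -[leRHS](Expect_cst (@mu_sum1 R n p)).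
  apply: ler_Expect => // x; under eq_bigl do rewrite subset0E.
  by rewrite big_pred1_eq cards0 mul1r chi0 mulr1.
have notin_sub S : S \subset A -> i \notin S.
  by move=> SA; apply: contra iA; exact: (subsetP SA).
rewrite sum_subset_setU1//.
rewrite [X in (_ + X) ^+ 2](_ : _ = u *
  \sum_(S : {set 'I_n} | S \subset A) u ^+ #|S| * c (i |: S) ^+ 2); last first.
  rewrite mulr_sumr; apply: eq_bigr => S SA.
  by rewrite cardsU1 notin_sub// exprD expr1 mulrA.
under eq_Expect => x.
  rewrite sum_subset_setU1// [X in _ + X](_ : _ = u * phi p (x i) *
    \sum_(S : {set 'I_n} | S \subset A) u ^+ #|S| * c (i |: S) * chi p S x); last first.
    rewrite mulr_sumr; apply: eq_bigr => S SA.
    by rewrite cardsU1 notin_sub// chi_setU1 ?notin_sub// exprD expr1; ring.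
  over.
apply: fourth_moment_tensor (IH c) (IH (fun S => c (i |: S))).
- by move=> x; apply: eq_bigr => S SA; rewrite chi_flip_notin ?notin_sub.
- by move=> x; apply: eq_bigr => S SA; rewrite chi_flip_notin ?notin_sub.
- by apply: sumr_ge0 => S _; rewrite mulr_ge0 ?sqr_ge0 ?exprn_ge0.
- by apply: sumr_ge0 => S _; rewrite mulr_ge0 ?sqr_ge0 ?exprn_ge0.
Qed.

Lemma hypercontractivity f :
  E (fun x => noise_op p u f x ^+ 4) <= noise_form p u f ^+ 2.
Proof.
have -> : noise_form p u f =
    \sum_(S : {set 'I_n} | S \subset setT) u ^+ #|S| * coef p f S ^+ 2.
  by rewrite noise_formE//; apply: eq_bigl => S; rewrite subsetT.
apply: le_trans (hypercontractivity_subset setT (coef p f)).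
apply: ler_Expect => // x; rewrite [noise_op p u f x](fourier_inversion p_gt0 p_lt1).
under eq_bigr do rewrite coef_noise_op//.
by under [in leRHS]eq_bigl do rewrite subsetT.
Qed.

End Hypercontractivity.

Section RealPowers.
Variable R : realType.
Implicit Types (y b : R).

Lemma powR_le_tangent y b : 0 <= y -> 0 < b <= 1 -> y `^ b <= 1 - b + b * y.
Proof.
move=> y_ge0 /andP[b_gt0]; rewrite le_eqVlt => /predU1P[->|b_lt1].
  by rewrite powRr1// subrr mul1r add0r.
have := @conjugate_powR R (y `^ b) 1 b^-1 (1 - b)^-1 (powR_ge0 _ _) ler01.
rewrite !invr_gt0 !invrK subr_gt0 -powRrM divff ?gt_eqF// powRr1// powR1 mulr1.
by move/(_ b_gt0 b_lt1 (subrKC _ _)); rewrite mul1r addrC mulrC.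
Qed.

Lemma powR_sum_le (I : finType) (P : pred I) (v x : I -> R) b :
  (forall i, 0 <= v i) -> (forall i, 0 <= x i) -> \sum_(i | P i) v i <= 1 ->
  0 < b <= 1 ->
  \sum_(i | P i) x i `^ b * v i <= (\sum_(i | P i) x i * v i) `^ b.
Proof.
move=> v_ge0 x_ge0 v_le1 b01; have /andP[b_gt0 b_le1] := b01.
set Y := \sum_(i | P i) x i * v i.
have xv_ge0 i : 0 <= x i * v i by rewrite mulr_ge0.
have Y_ge0 : 0 <= Y by apply: sumr_ge0.
have [Y0|Y_neq0] := eqVneq Y 0.
  rewrite Y0 powR0 ?gt_eqF// big1// => i Pi.
  have /eqP := psumr_eq0P (fun i _ => xv_ge0 i) Y0 Pi.
  by rewrite mulf_eq0 => /orP[] /eqP ->; rewrite ?mulr0// powR0 ?gt_eqF ?mul0r.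
apply: (@le_trans _ _ (\sum_(i | P i) Y `^ b * ((1 - b + b * (x i / Y)) * v i))).
  apply: ler_sum => i _; rewrite [leRHS]mulrA ler_wpM2r//.
  rewrite -{1}(mulfVK Y_neq0 (x i)) powRM ?divr_ge0// mulrC ler_wpM2l ?powR_ge0//.
  by rewrite powR_le_tangent ?divr_ge0.
rewrite -mulr_sumr ler_piMr ?powR_ge0//.
have -> : \sum_(i | P i) (1 - b + b * (x i / Y)) * v i =
    (1 - b) * (\sum_(i | P i) v i) + b * (Y / Y).
  by rewrite mulr_suml !mulr_sumr -big_split/=; apply: eq_bigr => i _; ring.
rewrite divff// mulr1 -lerBrDr.
by apply: ler_piMr; rewrite // subr_ge0.
Qed.

Lemma natr_mul_expRN_le (delta : R) k : 0 < delta ->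
  k%:R * expR (- delta) ^+ k <= delta^-1.
Proof.
move=> delta_gt0; rewrite -expRM_natl mulrN expRN ler_pdivrMr ?expR_gt0//.
rewrite -(ler_pM2l delta_gt0) mulVKf ?gt_eqF// mulrC.
by apply: le_trans (expR_ge1Dx _); rewrite lerDr.
Qed.

Lemma onem_le_expR_powR (eps M : R) : 0 <= eps -> 0 < eps + M ->
  1 - eps <= expR (- (M / 2)) `^ (2 * (eps / (eps + M))).
Proof.
move=> eps_ge0 epsM_gt0; apply: le_trans (expR_ge1Dx _) _; rewrite -expRM ler_expR.
rewrite (_ : - (M / 2) * _ = - eps + eps * (eps / (eps + M))); last by field; lra.
by rewrite lerDl mulr_ge0 ?divr_ge0// ltW.
Qed.

End RealPowers.

Section SpectralStability.
Variables (R : realType) (n : nat) (p : R).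
Hypotheses (p_gt0 : 0 < p) (p_lt1 : p < 1).
Implicit Types (i : 'I_n) (S : {set 'I_n}) (f g : cube n -> R) (u delta rho : R).
Local Notation E := (Expect (@mu R n p)).
Local Notation q := (1 - p).

Let mu_nneg (x : cube n) : 0 <= mu p x. Proof. exact: mu_ge0. Qed.

Lemma sum_coef_sqr g : \sum_(S : {set 'I_n}) coef p g S ^+ 2 = E (fun x => g x ^+ 2).
Proof. exact/esym/(parseval p_gt0 p_lt1 g g). Qed.

Lemma noise_form_L1_L2 u f : hypercontractive_rate p u ->
  noise_form p u f ^+ 2 <= E (fun x => `|f x|) ^+ 2 * E (fun x => f x ^+ 2).
Proof.
move=> u_rate; set Q := noise_form p u f; pose G := noise_op p u f.
pose K := E (fun x => `|f x| * G x ^+ 2).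
have f2_ge0 : 0 <= E (fun x => f x ^+ 2) by exact: Expect_sqr_ge0.
have Q2_le : Q ^+ 2 <= E (fun x => `|f x|) * K.
  apply: Cauchy_Schwarz_Expect => // x; first by rewrite mulr_ge0 ?sqr_ge0.
  by rewrite mulrA -normrM ger0_norm -?expr2 ?sqr_ge0// exprMn.
have K2_le : K ^+ 2 <= E (fun x => f x ^+ 2) * Q ^+ 2.
  apply: le_trans (ler_wpM2l f2_ge0 (hypercontractivity p_gt0 p_lt1 u_rate f)).
  apply: Cauchy_Schwarz_Expect => // x; rewrite ?sqr_ge0 ?exprn_even_ge0//.
  by rewrite exprMn -normrX ger0_norm ?sqr_ge0// -exprM.
have [->|Q_neq0] := eqVneq Q 0; first by rewrite expr0n mulr_ge0 ?sqr_ge0.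
have Q2_gt0 : 0 < Q ^+ 2 by rewrite exprn_even_gt0.
rewrite -(ler_pM2r Q2_gt0) -[leRHS]mulrA -expr2.
apply: (@le_trans _ _ ((E (fun x => `|f x|) * K) ^+ 2)).
  by rewrite lerXn2r ?nnegrE// ltW// (lt_le_trans Q2_gt0).
by rewrite exprMn ler_wpM2l ?sqr_ge0.
Qed.

Lemma sum_coord_part_coef (F : {set 'I_n} -> R) g :
  \sum_i \sum_(S : {set 'I_n}) F S * coef p (coord_part p i g) S ^+ 2 =
  \sum_(S : {set 'I_n}) #|S|%:R * (F S * coef p g S ^+ 2).
Proof.
rewrite -sum_mem_card; apply: eq_bigr => i _; apply: eq_bigr => S _.
by rewrite coef_coord_part//; case: (i \in S) => /=; ring.
Qed.

Lemma spectral_stability_le_sum_coord_part rho g : 0 <= rho ->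
  spectral_stability p rho g <=
  \sum_i \sum_(S : {set 'I_n}) rho ^+ #|S| * coef p (coord_part p i g) S ^+ 2.
Proof.
move=> rho_ge0; rewrite sum_coord_part_coef /spectral_stability big_mkcond.
apply: ler_sum => S _; have term_ge0 : 0 <= rho ^+ #|S| * coef p g S ^+ 2.
  by rewrite mulr_ge0 ?sqr_ge0 ?exprn_ge0.
case: ifPn => [S_neq0|_]; last by rewrite mulr_ge0.
by apply: ler_peMl; rewrite // ler1n card_gt0.
Qed.

Lemma coef_noise_op_sqr rho f S :
  coef p (noise_op p rho f) S ^+ 2 = (rho ^+ 2) ^+ #|S| * coef p f S ^+ 2.
Proof. by rewrite coef_noise_op// exprMn -!exprM mulnC. Qed.

Lemma sum_noisy_coord_part_le delta g : 0 < delta ->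
  \sum_i E (fun x => noise_op p (expR (- delta)) (coord_part p i g) x ^+ 2) <=
  (2 * delta)^-1 * E (fun x => g x ^+ 2).
Proof.
move=> delta_gt0; under eq_bigr => i _.
  rewrite -sum_coef_sqr (eq_bigr _ (fun S _ => coef_noise_op_sqr _ _ S)); over.
rewrite sum_coord_part_coef -sum_coef_sqr mulr_sumr; apply: ler_sum => S _.
rewrite mulrA ler_wpM2r ?sqr_ge0// -expRM_natl mulrN.
by rewrite natr_mul_expRN_le// mulr_gt0.
Qed.

(* The preliminary noise at rate [exp (- delta)] is what bounds the total influence
   of [g]; it is paid for by a factor [exp (- 2 delta)] in the rate. *)
Lemma spectral_stability_sqr_le u delta g :
  hypercontractive_rate p u -> 0 < delta ->
  spectral_stability p (u * expR (- delta) ^+ 2) g ^+ 2 <=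
  (\sum_i E (fun x => `|coord_part p i g x|) ^+ 2) *
  ((2 * delta)^-1 * E (fun x => g x ^+ 2)).
Proof.
move=> u_rate delta_gt0; have /andP[u_ge0 _] := u_rate; set w := expR (- delta).
have w01 : 0 <= w <= 1 by rewrite expR_ge0 expR_le1 oppr_le0 ltW.
have rate_ge0 : 0 <= u * w ^+ 2 by rewrite mulr_ge0 ?sqr_ge0.
pose h i := noise_op p w (coord_part p i g).
have stab_le : spectral_stability p (u * w ^+ 2) g <= \sum_i noise_form p u (h i).
  apply: le_trans (spectral_stability_le_sum_coord_part g rate_ge0) _.
  apply: ler_sum => i _; rewrite noise_formE//; apply: ler_sum => S _.
  by rewrite coef_noise_op_sqr [in leLHS]exprMn [leRHS]mulrA.
apply: (@le_trans _ _ ((\sum_i noise_form p u (h i)) ^+ 2)).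
  have stab_ge0 := spectral_stability_ge0 p g rate_ge0.
  by rewrite lerXn2r ?nnegrE// (le_trans stab_ge0).
apply: (le_trans _ (ler_wpM2l _ (sum_noisy_coord_part_le g delta_gt0))); last first.
  by apply: sumr_ge0 => i _; exact: sqr_ge0.
apply: Cauchy_Schwarz_sum => [i|i|i]; rewrite ?sqr_ge0//.
  exact: Expect_sqr_ge0.
apply: le_trans (noise_form_L1_L2 (h i) u_rate) _; rewrite ler_wpM2r//.
  exact: Expect_sqr_ge0.
by rewrite lerXn2r ?nnegrE ?Expect_ge0// noise_op_L1_contraction.
Qed.

Lemma spectral_stability_powR rho r b g :
  0 <= rho -> 0 <= r -> rho <= r `^ b -> 0 < b <= 1 -> E (fun x => g x ^+ 2) <= 1 ->
  spectral_stability p rho g <= spectral_stability p r g `^ b.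
Proof.
move=> rho_ge0 r_ge0 rho_le b01 g2_le1.
apply: (@le_trans _ _
    (\sum_(S : {set 'I_n} | S != set0) (r ^+ #|S|) `^ b * coef p g S ^+ 2)).
  apply: ler_sum => S _; rewrite ler_wpM2r ?sqr_ge0//.
  rewrite -(powR_mulrn _ r_ge0) powRAC powR_mulrn ?powR_ge0//.
  by rewrite lerXn2r ?nnegrE ?powR_ge0.
apply: powR_sum_le => // [S|S|]; [exact: sqr_ge0|exact: exprn_ge0|].
apply: le_trans g2_le1; rewrite -sum_coef_sqr big_mkcond; apply: ler_sum => S _.
by case: ifP => // _; exact: sqr_ge0.
Qed.

Variable f : cube n -> bool.
Let F (x : cube n) : R := (f x)%:R.

Lemma W_ge0 : 0 <= W p f.
Proof.
rewrite mulr_ge0 ?sumr_ge0//; first by rewrite ltW// mulr_gt0// subr_gt0.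
by move=> i _; exact: sqr_ge0.
Qed.

Lemma sum_norm_coord_part_le_W :
  \sum_i E (fun x => `|coord_part p i F x|) ^+ 2 <= W p f.
Proof.
rewrite /W mulr_sumr; apply: ler_sum => i _; rewrite Expect_norm_coord_part//.
rewrite exprMn ler_wpM2r ?sqr_ge0//.
have pq_ge0 : 0 <= p * q by rewrite ltW// mulr_gt0// subr_gt0.
by have := mulr_ge0 pq_ge0 (sqr_ge0 (1 - 2 * p)); lra.
Qed.

Lemma Expect_indicator_sqr_le1 : E (fun x => F x ^+ 2) <= 1.
Proof.
rewrite -[leRHS](mu_sum1 n p); apply: ler_Expect => // x.
by rewrite /F; case: (f x); rewrite ?expr1n ?expr0n.
Qed.

Lemma spectral_stability_sqr_le_W r delta : 0 < delta ->
  hypercontractive_rate p (r * expR delta ^+ 2) ->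
  spectral_stability p r F ^+ 2 <= (2 * delta)^-1 * W p f.
Proof.
move=> delta_gt0 r_rate.
have delta2_ge0 : 0 <= (2 * delta)^-1 by rewrite invr_ge0 mulr_ge0// ltW.
have := spectral_stability_sqr_le F r_rate delta_gt0.
rewrite -mulrA -exprMn expRxMexpNx_1 expr1n mulr1 => /le_trans; apply.
rewrite [leRHS]mulrC; apply: ler_pM sum_norm_coord_part_le_W _.
- by apply: sumr_ge0 => i _; exact: sqr_ge0.
- by rewrite mulr_ge0// Expect_sqr_ge0.
- by rewrite ler_piMr// Expect_indicator_sqr_le1.
Qed.

Lemma noise_stability_le eps M delta :
  0 < eps <= 1 -> eps <= M -> 0 < delta ->
  6 * expR (4 * delta) * (p / q + q / p) <= expR M ->
  noise_stability p eps f <= ((2 * delta)^-1 * W p f) `^ (eps / (eps + M)).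
Proof.
move=> /andP[eps_gt0 eps_le1] eps_leM delta_gt0 M_le.
have epsM_gt0 : 0 < eps + M by lra.
set a := eps / (eps + M); have a_gt0 : 0 < a by rewrite divr_gt0.
have a_le : 2 * a <= 1 by rewrite mulrA ler_pdivrMr//; lra.
pose r := expR (- (M / 2)); have r_ge0 : 0 <= r := expR_ge0 _.
have r_rate : hypercontractive_rate p (r * expR delta ^+ 2).
  rewrite /hypercontractive_rate mulr_ge0 ?sqr_ge0//=.
  have -> : (r * expR delta ^+ 2) ^+ 2 = expR (4 * delta) / expR M.
    by rewrite -expRB /r -expRM_natl -expRD -expRM_natl; congr expR; field.
  by rewrite mulrA mulrAC ler_pdivrMr ?expR_gt0// mul1r.
rewrite noise_stabilityE//.
apply: (@le_trans _ _ (spectral_stability p r F `^ (2 * a))).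
  apply: spectral_stability_powR Expect_indicator_sqr_le1 => //; first by lra.
    by rewrite onem_le_expR_powR// ltW.
  by rewrite mulr_gt0.
rewrite powRrM powR_mulrn ?spectral_stability_ge0//.
apply: ge0_ler_powR; rewrite ?nnegrE ?sqr_ge0 ?(ltW a_gt0)//.
  by rewrite mulr_ge0 ?W_ge0// invr_ge0 mulr_ge0// ltW.
exact: spectral_stability_sqr_le_W.
Qed.

End SpectralStability.

Section ExponentialInequalities.
Variable R : realType.
Implicit Types x z : R.

Lemma series_exp_coeff_le_expR x k : 0 <= x -> series (exp_coeff x) k <= expR x.
Proof.
move=> x_ge0; apply: nondecreasing_cvgn_le; last exact: is_cvg_series_exp_coeff.
by apply/nondecreasing_series => i _ _; exact: exp_coeff_ge0.
Qed.

Lemma expR_ge_quadratic x : 0 <= x -> 1 + x + x ^+ 2 / 2 <= expR x.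
Proof.
move=> /(series_exp_coeff_le_expR 3); rewrite /series/= !big_nat_recr//= big_nil.
by rewrite /exp_coeff/= !factS fact0; lra.
Qed.

Lemma expR_mul_onem_le1 x : expR x * (1 - x) <= 1.
Proof. by rewrite -[leRHS](expRxMexpNx_1 x) ler_pM2l ?expR_gt0// expR_ge1Dx. Qed.

Lemma sinh_ge x : 0 <= x -> 2 * x <= expR x - expR (- x).
Proof.
move=> x_ge0; have := expR_ge_quadratic x_ge0; set g := 1 + x + x ^+ 2 / 2 => g_le.
have g_gt0 : 0 < g by rewrite /g; have := sqr_ge0 x; lra.
have expN_le : expR (- x) <= g^-1 by rewrite expRN lef_pV2 ?posrE// expR_gt0.
have : 2 * x <= g - g^-1.
  rewrite -(ler_pM2r g_gt0) mulrBl mulVf ?gt_eqF//.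
  by have : 0 <= x ^+ 4 by [rewrite exprn_even_ge0]; rewrite /g; lra.
lra.
Qed.

Lemma expR_le_cosh_half z : expR (1 / 2 + z / 4) <= expR (z / 2) + expR (- (z / 2)).
Proof.
have expR_half_le : expR (1 / 2) <= 7 / 4 :> R.
  have expR_sixth_le : expR (1 / 6) <= 6 / 5 :> R.
    by have := expR_mul_onem_le1 (1 / 6); lra.
  rewrite (_ : 1 / 2 = 3%:R * (1 / 6)); last by field.
  rewrite expRM_natl; apply: (@le_trans _ _ ((6 / 5) ^+ 3)); last by lra.
  by rewrite lerXn2r ?nnegrE ?expR_ge0//; lra.
set w := expR (z / 4); have w_gt0 : 0 < w by exact: expR_gt0.
have wE : expR (z / 2) = w ^+ 2 by rewrite -expRM_natl; congr expR; field.
rewrite expRD expRN wE; apply: (@le_trans _ _ (7 / 4 * w)); first by rewrite ler_pM2r.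
rewrite -(ler_pM2r (exprn_gt0 2 w_gt0)) [leRHS]mulrDl mulVf ?gt_eqF ?exprn_gt0//.
(* [w ^+ 4 - 7 / 4 * w ^+ 3 + 1] is the first square plus a quadratic polynomial with
   minimum at [w = 168 / 139]. *)
have := sqr_ge0 (w ^+ 2 - 7 / 8 * w - 3 / 5); have := sqr_ge0 (139 * w - 168).
lra.
Qed.

Definition sinhc z : R := if z == 0 then 1 else (expR z - expR (- z)) / (2 * z).

Lemma sinhcN z : sinhc (- z) = sinhc z.
Proof.
rewrite /sinhc oppr_eq0; case: eqP => // /eqP z_neq0.
by rewrite opprK; field.
Qed.

Lemma sinhc_ge1 z : 0 <= z -> 1 <= sinhc z.
Proof.
move=> z_ge0; rewrite /sinhc; have [//|z_neq0] := eqVneq z 0.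
by rewrite ler_pdivlMr ?mul1r ?sinh_ge// mulr_gt0// lt_def z_neq0.
Qed.

Lemma sinhc_gt0 z : 0 <= z -> 0 < sinhc z.
Proof. by move=> /sinhc_ge1; exact: lt_le_trans. Qed.

Lemma sinhc_double z :
  2 * sinhc z = (expR (z / 2) + expR (- (z / 2))) * sinhc (z / 2).
Proof.
rewrite /sinhc mulf_eq0 invr_eq0 pnatr_eq0 orbF.
have [->|z_neq0] := eqVneq z 0; first by rewrite mul0r oppr0 expR0; ring.
have expR_sqr : expR (z / 2) ^+ 2 = expR z by rewrite -expRM_natl; congr expR; field.
have expRN_sqr : expR (- (z / 2)) ^+ 2 = expR (- z).
  by rewrite -expRM_natl; congr expR; field.
by rewrite -expR_sqr -expRN_sqr; field.
Qed.

Lemma expR_le_sinhc z : 0 <= z -> expR (1 / 2 + z / 4) <= 2 * sinhc z.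
Proof.
move=> z_ge0; rewrite sinhc_double; apply: le_trans (expR_le_cosh_half z) _.
by rewrite ler_peMr ?addr_ge0 ?expR_ge0// sinhc_ge1// divr_ge0.
Qed.

Lemma cosh_le_sinhc z : 0 <= z -> expR z + expR (- z) <= 2 * sinhc z * (1 + z).
Proof.
move=> z_ge0; rewrite /sinhc; have [->|z_neq0] := eqVneq z 0.
  by rewrite oppr0 expR0; lra.
have z_gt0 : 0 < z by rewrite lt_def z_neq0.
rewrite (_ : _ * (1 + z) = (expR z - expR (- z)) * (1 + z) / z); last by field.
rewrite ler_pdivlMr//.
have : (1 + 2 * z) * expR (- z) <= expR z.
  by rewrite expRN ler_pdivrMr ?expR_gt0// -expr2 -expRM_natl expR_ge1Dx.
lra.
Qed.

Lemma ln_sinhc_ge z : 0 <= z -> 3 / 2 + z / 4 <= ln (2 * sinhc z * expR 1).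
Proof.
move=> z_ge0; rewrite -[leLHS]expRK ler_ln ?posrE ?expR_gt0//; last first.
  by rewrite mulr_gt0 ?expR_gt0// mulr_gt0// sinhc_gt0.
rewrite (_ : 3 / 2 + z / 4 = 1 / 2 + z / 4 + 1); last by field.
by rewrite expRD ler_pM2r ?expR_gt0// expR_le_sinhc.
Qed.

(* Here [1 / 18] is [4 delta] with [delta = 1 / 72]. *)
Lemma cosh_le_sinhc_ln_cube z : 0 <= z ->
  6 * expR (1 / 18) * (expR z + expR (- z)) <=
  2 * sinhc z * expR 1 * ln (2 * sinhc z * expR 1) ^+ 3.
Proof.
move=> z_ge0; set L := ln _.
have s_gt0 : 0 < 2 * sinhc z by rewrite mulr_gt0 ?sinhc_gt0.
have L3_ge : 13 / 5 * (1 + z) <= L ^+ 3.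
  have L_ge : 3 / 2 + z / 4 <= L := ln_sinhc_ge z_ge0.
  apply: (@le_trans _ _ ((3 / 2 + z / 4) ^+ 3)); last first.
    by rewrite lerXn2r ?nnegrE//; lra.
  have : 0 <= (z - 3 / 2) ^+ 2 * (z + 3) by rewrite mulr_ge0 ?sqr_ge0//; lra.
  by have := sqr_ge0 (z - 3 / 2); lra.
have expR1_ge : 5 / 2 <= expR 1 :> R by have := expR_ge_quadratic (@ler01 R); lra.
have expR_eighteenth_le : expR (1 / 18) <= 18 / 17 :> R.
  by have := expR_mul_onem_le1 (1 / 18); lra.
apply: (@le_trans _ _ (6 * (18 / 17) * (2 * sinhc z * (1 + z)))).
  by rewrite ler_pM ?mulr_ge0 ?addr_ge0 ?expR_ge0 ?cosh_le_sinhc// ler_pM2l.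
apply: (@le_trans _ _ (2 * sinhc z * (5 / 2) * (13 / 5 * (1 + z)))).
  by have := mulr_gt0 s_gt0 (_ : 0 < 1 + z); lra.
by rewrite ler_pM ?mulr_ge0 ?ler_pM2l//; lra.
Qed.

End ExponentialInequalities.

Section DecayExponent.
Variables (R : realType) (p : R).
Hypotheses (p_gt0 : 0 < p) (p_lt1 : p < 1).
Local Notation q := (1 - p).
Local Notation z := (ln q - ln p).

Let q_gt0 : 0 < q. Proof. by rewrite subr_gt0. Qed.

Lemma expR_log_odds : expR z = q / p.
Proof. by rewrite expRB !lnK ?posrE. Qed.

Lemma expRN_log_odds : expR (- z) = p / q.
Proof. by rewrite opprB expRB !lnK ?posrE. Qed.

Lemma cosh_log_odds : p / q + q / p = expR `|z| + expR (- `|z|).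
Proof.
rewrite -expR_log_odds -expRN_log_odds.
by have [_|_] := ler0P z; rewrite ?opprK// addrC.
Qed.

Lemma B_sinhc : B p = sinhc `|z|.
Proof.
transitivity (sinhc z); last by have [_|//] := ler0P z; rewrite sinhcN.
rewrite /B /sinhc expR_log_odds expRN_log_odds subr_eq0.
rewrite (inj_in_eq (@ln_inj R)) ?posrE//.
have -> : (p == 1 / 2) = (q == p) by apply/eqP/eqP => ?; lra.
case: eqP => // /eqP q_neq_p.
have z_neq0 : z != 0 by rewrite subr_eq0 (inj_in_eq (@ln_inj R)) ?posrE.
by field; rewrite z_neq0 !gt_eqF.
Qed.

Definition decay_exponent : R :=
  ln (2 * B p * expR 1) + 3 * ln (ln (2 * B p * expR 1)).

Lemma ln_B_ge : 3 / 2 <= ln (2 * B p * expR 1).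
Proof.
by rewrite B_sinhc; apply: le_trans (ln_sinhc_ge _); rewrite ?lerDl ?divr_ge0.
Qed.

Lemma decay_exponent_ge1 : 1 <= decay_exponent.
Proof.
rewrite /decay_exponent; have L_ge := ln_B_ge; set L := ln _ in L_ge *.
by have : 0 <= ln L; [rewrite ln_ge0; lra | lra].
Qed.

Lemma expR_decay_exponent_ge :
  6 * expR (1 / 18) * (p / q + q / p) <= expR decay_exponent.
Proof.
have B_gt0 : 0 < 2 * B p * expR 1.
  by rewrite mulr_gt0 ?expR_gt0// mulr_gt0// B_sinhc sinhc_gt0.
rewrite /decay_exponent expRD expRM_natl !lnK ?posrE//; last first.
  by have := ln_B_ge; lra.
by rewrite cosh_log_odds B_sinhc cosh_le_sinhc_ln_cube.
Qed.

End DecayExponent.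

Theorem theorem1p7 (R : realType) (n : nat) (p : R) (f : cube n -> bool)
    (hp0 : 0 < p) (hp1 : p < 1) (eps : R) (heps0 : 0 < eps) (heps1 : eps <= 1) :
  noise_stability p eps f <=
    (6 * expR 1 + 1) * powR (W p f) (alpha p eps * eps).
Proof.
have M_ge1 := decay_exponent_ge1 hp0 hp1.
have M_le := expR_decay_exponent_ge hp0 hp1.
set M := decay_exponent p in M_ge1 M_le.
have -> : alpha p eps * eps = eps / (eps + M) by rewrite /alpha addrA mul1r mulrC.
set a := eps / (eps + M).
have a_le : a <= 2^-1 by rewrite ler_pdivrMr; lra.
have stability_le : noise_stability p eps f <= (36 * W p f) `^ a.
  rewrite (_ : 36 = (2 * (1 / 72))^-1); last by field.
  apply: noise_stability_le => //; [by rewrite heps0 | lra | lra |].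
  by rewrite (_ : 4 * (1 / 72) = 1 / 18)//; field.
apply: le_trans stability_le _; rewrite powRM ?W_ge0// ler_wpM2r ?powR_ge0//.
apply: (@le_trans _ _ (36 `^ 2^-1)); first by rewrite ler_powR//; lra.
rewrite powR12_sqrt// (_ : 36 = 6 ^+ 2); last by ring.
by rewrite sqrtr_sqr ger0_norm//; have := expR_ge1Dx (1 : R); lra.
Qed.
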